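(* Let $k\geq1$, let $(X,d)$ be a compact metric space, let $T:\mathbb{Z}^k\times X\to X$ be an expansive continuous action and let $R:\mathbb{Z}^{k-1}\times X\to X$ be a continuous action commuting with $T$. If the topological entropy of $T$ is zero, then $\mathrm{mdim}(X,R)=0$.
   Context: Expansive: there is $c>0$ with $\sup_{u\in\mathbb{Z}^k}d(T^ux,T^uy)>c$ for distinct $x,y$. For a continuous action $S$ of $\mathbb{Z}^m$ and $\Omega\subset\mathbb{R}^m$, $d^S_\Omega(x,y)=\sup_{u\in\Omega\cap\mathbb{Z}^m}d(S^ux,S^uy)$. Topological entropy: $h_{\mathrm{top}}(T)=\lim_{\varepsilon\to0}\lim_{N\to\infty}\log\#(X,d^T_{[-N,N]^k},\varepsilon)/(2N+1)^k$, where $\#(X,\rho,\varepsilon)$ is the minimal cardinality of an open cover of $X$ whose members have $\rho$-diameter $<\varepsilon$. Mean dimension: $\mathrm{ord}(\mathcal{U})$ is the largest $n$ such that $n+1$ distinct members of the open cover $\mathcal{U}$ intersect; $\mathrm{widim}_\varepsilon(X,\rho)$ is the minimal order of an open cover with all $\rho$-diameters $\leq\varepsilon$; $\mathrm{mdim}(X,S)=\lim_{\varepsilon\to0}\lim_{N\to\infty}\mathrm{widim}_\varepsilon(X,d^S_{[-N,N]^m})/(2N+1)^m$ (for $m=0$ it is $\dim X$). *)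

(* Defs.v *)
From HB Require Import structures.
From mathcomp Require Import all_boot all_order all_algebra.
From mathcomp Require Import all_classical all_reals all_analysis.
From mathcomp Require Import Rstruct Rstruct_topology.
Set Implicit Arguments. Unset Strict Implicit. Unset Printing Implicit Defensive.
Import Order.TTheory GRing.Theory Num.Theory.
Import numFieldNormedType.Exports.
Local Open Scope classical_set_scope.
Local Open Scope ring_scope.

Section MetricDynamics.
Variable R : realType.
Variable X : Type.
Variable d : X -> X -> R.

Definition is_metric : Prop :=
  (forall x y, 0 <= d x y) /\ (forall x y, d x y = 0 <-> x = y) /\
  (forall x y, d x y = d y x) /\ (forall x y z, d x z <= d x y + d y z).

Definition mopen (A : set X) : Prop :=
  forall x, A x -> exists r, 0 < r /\ (forall y, d x y < r -> A y).

Definition mcompact : Prop :=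
  forall (I : Type) (U : I -> set X), (forall i, mopen (U i)) ->
    (forall x, exists i, U i x) ->
    exists n (f : 'I_n -> I), forall x, exists j, U (f j) x.

Definition mcontinuous (f : X -> X) : Prop :=
  forall x e, 0 < e -> exists dl, 0 < dl /\ forall y, d x y < dl -> d (f x) (f y) < e.

Definition is_action (m : nat) (S : ('I_m -> int) -> X -> X) : Prop :=
  (forall x, S (fun _ => 0) x = x) /\
  (forall u v x, S (fun i => u i + v i) x = S u (S v x)).

Definition continuous_action (m : nat) (S : ('I_m -> int) -> X -> X) : Prop :=
  is_action S /\ forall u, mcontinuous (S u).

Definition expansive (m : nat) (S : ('I_m -> int) -> X -> X) : Prop :=
  exists c : R, 0 < c /\ forall x y, x <> y ->
    (c%:E < ereal_sup [set (d (S u x) (S u y))%:E | u in [set: 'I_m -> int]])%E.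

Definition commuting (k m : nat) (S : ('I_k -> int) -> X -> X)
  (S' : ('I_m -> int) -> X -> X) : Prop :=
  forall u v x, S u (S' v x) = S' v (S u x).

Definition in_cube (m N : nat) (u : 'I_m -> int) : Prop :=
  forall i, - (N%:Z) <= u i <= N%:Z.

Definition bowen (m : nat) (S : ('I_m -> int) -> X -> X) (N : nat) (x y : X) : R :=
  sup [set d (S u x) (S u y) | u in in_cube N].

Definition diam (rho : X -> X -> R) (A : set X) : \bar R :=
  ereal_sup [set (rho x y)%:E | x in A & y in A].

Definition covnum (rho : X -> X -> R) (eps : R) : R :=
  inf [set n%:R | n in [set n : nat | exists U : 'I_n -> set X,
         (forall i, mopen (U i) /\ (diam rho (U i) < eps%:E)%E) /\
         (forall x, exists i, U i x)]].

Definition ord (m : nat) (U : 'I_m -> set X) : R :=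
  sup [set n%:R | n in [set n : nat | exists f : 'I_n.+1 -> 'I_m,
         (forall i j, U (f i) = U (f j) -> i = j) /\ exists x, forall i, U (f i) x]].

Definition widim (rho : X -> X -> R) (eps : R) : R :=
  inf [set o | exists m (U : 'I_m -> set X),
         (forall i, mopen (U i) /\ (diam rho (U i) <= eps%:E)%E) /\
         (forall x, exists i, U i x) /\ o = ord U].

Definition is_htop (k : nat) (T : ('I_k -> int) -> X -> X) (h : \bar R) : Prop :=
  exists g : R -> \bar R,
    (forall eps, 0 < eps ->
       (fun N : nat => (ln (covnum (bowen T N) eps) / ((2 * N + 1) ^ k)%:R)%:E)
         @ \oo --> g eps) /\
    g e @[e --> 0^'+] --> h.

Definition is_mdim (m : nat) (S : ('I_m -> int) -> X -> X) (D : \bar R) : Prop :=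
  exists g : R -> \bar R,
    (forall eps, 0 < eps ->
       (fun N : nat => (widim (bowen S N) eps / ((2 * N + 1) ^ m)%:R)%:E)
         @ \oo --> g eps) /\
    g e @[e --> 0^'+] --> D.

End MetricDynamics.

(* Main.v *)
Require Import Defs.
From HB Require Import structures.
From mathcomp Require Import all_boot all_order all_algebra.
From mathcomp Require Import all_classical all_reals all_analysis.
From mathcomp Require Import Rstruct Rstruct_topology.
From mathcomp Require Import zify ring lra.
Set Implicit Arguments. Unset Strict Implicit. Unset Printing Implicit Defensive.
Import Order.TTheory GRing.Theory Num.Theory.
Import numFieldNormedType.Exports.
Local Open Scope classical_set_scope.
Local Open Scope ring_scope.

(* Let c be an expansivity constant of T.  Compactness gives L0 such that if the
   T-orbits of x, y stay c-close on the cube of radius L0 + M, they stay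
   (c/2)-close on the cube of radius M.  So, writing V l for the relation
   "c-close on the cube of radius L0 * l + L2", two steps of V (l+1) lie in one
   step of V l, and a V (N+2)-chain of 2^(N+1) steps is still short in d.  This
   yields 2^N nested sets B_0, B_2, B_4, ... around each of D fixed centres, all
   of small diameter, whose boundary layers {dist (., B_2t) = dl/2} are such that
   a V (N+2)-small set meets at most one of them.

   Since R commutes with T, closeness of T-orbits at radius (const * N) controls
   all R^v, v in the N-cube, up to V (N+2); by zero entropy X is covered by
   M = exp(o(N^k)) sets of this kind.  For each pair (v, centre) choose one of the
   2^N layers.  A union bound over the M sets and the subsets of these
   D(2N+1)^(k-1) pairs shows that for n of order o(N^(k-1)) some choice has no
   point lying in more than n chosen layers at once.  The layers then cut X into
   cells like the faces of a cube complex of dimension n, so the widim is <= n. *)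

(** * A counting argument *)

(** Union bound over the pairs ([w], [S]) with [m <= #|S|]: at most one value per coordinate of [S]
    is critical, so a pair rules out at most one choice in [K ^ m], and there are at most
    [M * 2 ^ #|A|] pairs. *)
Lemma exists_few_simultaneous (A : finType) (K M m : nat)
    (crit : 'I_M -> A -> 'I_K -> bool) :
  (0 < K)%N ->
  (forall w a s t, crit w a s -> crit w a t -> s = t) ->
  (M * 2 ^ #|A| < K ^ m)%N ->
  exists xi : {ffun A -> 'I_K}, forall w (S : {set A}),
    (forall a, a \in S -> crit w a (xi a)) -> (#|S| < m)%N.
Proof.
move=> K0 crit1 small.
pose bad w (S : {set A}) :=
  [set xi : {ffun A -> 'I_K} | [forall a in S, crit w a (xi a)]]%SET.
have card_bad w (S : {set A}) : (m <= #|S|)%N -> (#|bad w S| * K ^ m <= K ^ #|A|)%N.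
  move=> mS.
  have : (#|bad w S| <= K ^ #|~: S|)%N.
    pose F (a : A) : pred 'I_K := if a \in S then crit w a else predT.
    have -> : #|bad w S| = #|family F|.
      apply: eq_card => xi; rewrite inE; apply/forall_inP/familyP => h a.
        by rewrite /F; case: ifP => // aS; exact: h.
      by move=> aS; have := h a; rewrite /F aS.
    rewrite card_family foldrE big_map enumT -enumT big_enum /=.
    rewrite -sum1dep_card expn_sum.
    rewrite [leqRHS]big_mkcond /=; apply: leq_prod => a _.
    rewrite /F; case: (a \in S) => /=; last by rewrite expn1 cardT size_enum_ord.
    apply/card_le1P => s cs t; apply/idP/eqP => [ct|->//].
    by apply: (crit1 w a); [exact: ct | exact: cs].
  move=> h; apply: (leq_trans (leq_mul h (leqnn _))).
  rewrite -expnD leq_pexp2l //.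
  by have := cardsC S; lia.
apply/not_existsP => allbad.
have tot : (K ^ #|A| <= \sum_(w < M) \sum_(S : {set A} | (m <= #|S|)%N) #|bad w S|)%N.
  rewrite -{1}(card_ord K) -card_ffun -sum1_card.
  under [leqRHS]eq_bigr => w _ do
    under eq_bigr => S _ do rewrite -sum1_card big_mkcond /=.
  under [leqRHS]eq_bigr => w _ do rewrite exchange_big /=.
  rewrite exchange_big /=; apply: leq_sum => xi _.
  have /existsNP[w /existsNP[S /not_implyP[h /negP]]] := allbad xi.
  rewrite -leqNgt => mS.
  rewrite (bigD1 w) //= (bigD1 S) //= inE ifT //.
  by apply/forall_inP.
have : (K ^ #|A| * K ^ m <= M * 2 ^ #|A| * K ^ #|A|)%N.
  apply: (leq_trans (leq_mul tot (leqnn _))).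
  rewrite big_distrl /= -mulnA -[in leqRHS](card_ord M) -sum_nat_const.
  apply: leq_sum => w _; rewrite big_distrl /=.
  rewrite -[#|A|]cardsT -card_powerset -sum_nat_const.
  rewrite [leqLHS]big_mkcond [leqRHS]big_mkcond /=; apply: leq_sum => S _.
  rewrite inE finset.subsetT cardsT; case: ifP => // mS.
  exact: card_bad.
by rewrite mulnC leq_pmul2r ?expn_gt0 ?K0// leqNgt small.
Qed.

(** * Covers of small order *)

Local Ltac use_true := repeat match goal with
  | H : is_true true -> _ |- _ => specialize (H isT)
  | H : is_true false -> _ |- _ => clear H
  end.

Section MetricSpace.
Variables (R : realType) (X : Type) (d : X -> X -> R).

Definition fcontinuous (f : X -> R) : Prop :=
  forall x e, 0 < e -> exists dl, 0 < dl /\ forall y, d x y < dl -> `|f x - f y| < e.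

Lemma common_radius (I : finType) (Q : I -> R -> Prop) :
  (forall i r s, s <= r -> Q i r -> Q i s) ->
  (forall i, exists r, 0 < r /\ Q i r) ->
  exists r, 0 < r /\ forall i, Q i r.
Proof.
(* The starting value 1 keeps the radius positive when [I] is empty. *)
move=> anti /choice[f fP]; exists (\big[Num.min/1]_i f i); split.
  by apply: lt_bigmin => // i _; case: (fP i).
by move=> i; apply: (anti i (f i)); [exact: bigmin_le_cond | case: (fP i)].
Qed.

Lemma mopen_forall (I : finType) (P : I -> set X) :
  (forall i, mopen d (P i)) -> mopen d [set x | forall i, P i x].
Proof.
move=> oP x Px.
have [|i|r [r0 h]] := @common_radius I (fun i r => forall y, d x y < r -> P i y).
- by move=> i r s sr h y /lt_le_trans/(_ sr); exact: h.
- by have [r [r0 h]] := oP i x (Px i); exists r.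
by exists r; split => // y xy i; exact: h xy.
Qed.

Lemma mopenI (A B : set X) : mopen d A -> mopen d B -> mopen d (A `&` B).
Proof.
move=> oA oB x [/oA[r [r0 hr]] /oB[s [s0 hs]]].
exists (Num.min r s); split; first by rewrite lt_min r0.
by move=> y; rewrite lt_min => /andP[/hr ? /hs].
Qed.

Lemma mopen_imply (b : bool) (A : set X) :
  (b -> mopen d A) -> mopen d [set x | b -> A x].
Proof.
case: b => [oA x /(_ isT) /(oA isT)[r [r0 h]]|_ x _]; last by exists 1; split.
by exists r; split => // y /h ? _.
Qed.

Lemma fcontinuous_norm f : fcontinuous f -> fcontinuous (fun x => `|f x|).
Proof.
move=> cf x e /(cf x)[r [r0 h]]; exists r; split => // y /h.
exact/le_lt_trans/ler_dist_dist.
Qed.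

Lemma fcontinuous_cst c : fcontinuous (fun=> c).
Proof. by move=> x e e0; exists 1; split => // y _; rewrite subrr normr0. Qed.

Lemma mopen_lt f g :
  fcontinuous f -> fcontinuous g -> mopen d [set x | f x < g x].
Proof.
move=> cf cg x /= fg; have e0 : 0 < (g x - f x) / 2 by lra.
have [r [r0 hr]] := cf x _ e0; have [s [s0 hs]] := cg x _ e0.
exists (Num.min r s); split; first by rewrite lt_min r0.
move=> y; rewrite lt_min => /andP[/hr + /hs].
by rewrite !ltr_norml; lra.
Qed.

Lemma ord_le (m N : nat) (U : 'I_N -> set X) :
  (forall x n (f : 'I_n.+1 -> 'I_N), (forall i j, U (f i) = U (f j) -> i = j) ->
     (forall i, U (f i) x) -> (n <= m)%N) ->
  0 <= ord R U <= m%:R.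
Proof.
move=> h; rewrite /ord; set E := [set _ | _ in _].
have ubE : ubound E m%:R.
  by move=> _ [n [f [finj [x fx]]] <-]; rewrite ler_nat; exact: h finj fx.
(* The default [sup set0 = 0] occurs when no point lies in any member. *)
have [->|E0] := eqVneq E set0; first by rewrite sup0 lexx ler0n.
have {}E0 : E !=set0 by exact/set0P.
apply/andP; split; last exact: ge_sup.
case: E0 => r Er; apply: (@le_trans _ _ r); first by case: Er => n _ <-.
by apply: ub_le_sup => //; exists m%:R.
Qed.

Lemma ord_ge0 (N : nat) (U : 'I_N -> set X) : 0 <= ord R U.
Proof.
suff /(@ord_le N N U)/andP[] : forall x n (f : 'I_n.+1 -> 'I_N),
    (forall i j, U (f i) = U (f j) -> i = j) -> (forall i, U (f i) x) -> (n <= N)%N by [].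
move=> x n f finj _; rewrite -[N in leqRHS]card_ord ltnW// -[n.+1]card_ord.
by apply: (leq_card f) => i j /(congr1 U) /finj.
Qed.

Lemma widim_ge0 rho eps : 0 <= widim d rho eps.
Proof.
rewrite /widim; set E := [set _ | _].
have [->|/set0P E0] := eqVneq E set0; first by rewrite inf0.
by apply: lb_le_inf => // _ [n [U [_ [_ ->]]]]; exact: ord_ge0.
Qed.

(* Barycentric subdivision of a cube: the cell V S P is a neighbourhood of the
   open face on which exactly the coordinates in S are undecided.  Two cells
   with the same #|S| are disjoint or equal since a coordinate of S \ S' would
   be both smaller and larger than one of S' \ S; hence the order is <= m. *)
Lemma widim_le_zeros (A : finType) (phi : A -> X -> R) (th eps : R) (m : nat)
    (rho : X -> X -> R) :
  0 < th -> (forall a, fcontinuous (phi a)) ->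
  (forall x (S : {set A}), (forall a, a \in S -> phi a x = 0) -> (#|S| <= m)%N) ->
  (forall x y, (forall a, phi a x <= 0 -> phi a y < th) -> rho x y <= eps) ->
  widim d rho eps <= m%:R.
Proof.
move=> th0 cphi few small.
pose V (S P : {set A}) : set X := [set x | (#|S| <= m)%N /\ forall a b,
  ((a \in S) -> phi a x < th) /\ ((a \in S) && (b \notin S) -> `|phi a x| < `|phi b x|) /\
  ((a \notin S) && (a \in P) -> 0 < phi a x) /\
  ((a \notin S) && (a \notin P) -> phi a x < 0)].
have oV S P : mopen d (V S P).
  have [mS|mS] := boolP (#|S| <= m)%N; last by move=> x [h]; rewrite h in mS.
  apply: mopenI; first by move=> x _; exists 1.
  apply: mopen_forall => a; apply: mopen_forall => b.
  repeat apply: mopenI; apply: mopen_imply => _; apply: mopen_lt => //;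
    by [exact: fcontinuous_cst | exact: fcontinuous_norm].
(* A common point fixes the signs off [S], so [P] and [P'] agree there and give the same set. *)
have subV S P P' x : V S P x -> V S P' x -> V S P `<=` V S P'.
  move=> [mS Vx] [_ Vx'] y [_ Vy]; split => // a b.
  have [Va [Vab [VP VN]]] := Vy a b; split => //; split => //.
  have [_ [_ [VPx VNx]]] := Vx a b; have [_ [_ [VPx' VNx']]] := Vx' a b.
  move: VP VN VPx VNx VPx' VNx'.
  by case: (a \in S); case: (a \in P); case: (a \in P') => /= *; split=> // _;
    use_true; lra.
have subS S S' P P' x : V S P x -> V S' P' x -> #|S| = #|S'| -> S \subset S'.
  move=> [_ Vx] [_ Vx'] SS'; apply/fintype.subsetP => a aS; apply/negPn/negP => aS'.
  have : ~~ (S' \subset S).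
    apply/negP => sub; have /eqP E : S' == S by rewrite eqEcard sub SS' leqnn.
    by rewrite E aS in aS'.
  case/fintype.subsetPn => b bS' bS.
  have [_ [/(_ _)/lt_trans h _]] := Vx a b.
  have [_ [h' _]] := Vx' b a.
  have := h _ _ (h' _); rewrite aS bS bS' aS' => /(_ isT isT).
  by rewrite ltxx.
have eqV S S' P P' x : V S P x -> V S' P' x -> #|S| = #|S'| -> V S P = V S' P'.
  move=> Vx Vx' SS'.
  have E : S = S'.
    apply/eqP; rewrite finset.eqEsubset (subS _ _ _ _ _ Vx Vx' SS').
    exact: subS Vx' Vx (esym SS').
  rewrite -E in Vx' *; apply/seteqP; split; exact: subV Vx Vx' || exact: subV Vx' Vx.
pose N := #|{: {set A} * {set A}}|.
pose U (i : 'I_N) : set X := V (enum_val i).1 (enum_val i).2.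
apply: (@le_trans _ _ (ord R U)).
  apply: ge_inf; first by exists 0 => _ [n [U' [_ [_ ->]]]]; exact: ord_ge0.
  exists N, U; split; [|split => //].
    move=> i; split; first exact: oV.
    apply: ge_ereal_sup => _ [x [_ Vx] [y [_ Vy] <-]]; rewrite lee_fin.
    (* If [phi a x <= 0], then [a] is either undecided, so [phi a y < th], or negative on the whole
       cell. *)
    apply: small => a ax; have [Vax [_ [Vpx Vnx]]] := Vx a a.
    have [Vay [_ [Vpy Vny]]] := Vy a a.
    move: Vax Vpx Vnx Vay Vpy Vny.
    by case: (_ \in _); case: (_ \in _) => /= *; use_true; lra.
  move=> x; pose S := [set a | phi a x == 0]%SET; pose P := [set a | phi a x > 0]%SET.
  exists (enum_rank (S, P)); rewrite /U enum_rankK /=; split.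
    by apply: (few x) => a; rewrite inE => /eqP.
  move=> a b; rewrite !inE; split; first by move=> /eqP ->.
  split; first by move=> /andP[/eqP-> ]; rewrite normr0 normr_gt0.
  split; first by case/andP.
  by move=> /andP[a0]; rewrite -leNgt le_eqVlt (negbTE a0).
suff /ord_le/andP[] : forall x n (f : 'I_n.+1 -> 'I_N),
    (forall i j, U (f i) = U (f j) -> i = j) -> (forall i, U (f i) x) -> (n <= m)%N by [].
move=> x n f finj fx.
have cardS i : (#|(enum_val (f i)).1| < m.+1)%N by case: (fx i).
suff : (#|'I_n.+1| <= #|'I_m.+1|)%N by rewrite !card_ord.
(* The members through [x] are told apart by [#|S|], which has only the values 0 to [m]. *)
apply: (leq_card (fun i => Ordinal (cardS i))) => i j [ij]; apply: finj.
exact: eqV (fx i) (fx j) ij.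
Qed.

End MetricSpace.

(** * Expansive actions on compact metric spaces *)

Section Cubes.
Variable m : nat.

(** Indexes the cube by a finite type, for finite minima and for counting. *)
Definition cube_point (N : nat) (j : {ffun 'I_m -> 'I_(2 * N + 1)}) : 'I_m -> int :=
  fun i => (j i)%:Z - N%:Z.

Lemma in_cube_point N j : in_cube N (@cube_point N j).
Proof. by move=> i; rewrite /cube_point; have := ltn_ord (j i); lia. Qed.

Lemma cube_pointP N u : in_cube N u -> exists j, u = @cube_point N j.
Proof.
move=> uN.
have lt i : (absz (u i + N%:Z)%R < 2 * N + 1)%N by have := uN i; lia.
exists [ffun i => Ordinal (lt i)]; apply/funext => i.
by rewrite /cube_point ffunE /=; have := uN i; lia.
Qed.

Lemma in_cube_le (N N' : nat) (u : 'I_m -> int) : (N <= N')%N -> in_cube N u -> in_cube N' u.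
Proof. by move=> NN' uN i; have := uN i; lia. Qed.

Lemma in_cubeD (N N' : nat) (u v : 'I_m -> int) :
  in_cube N u -> in_cube N' v -> in_cube (N + N') (fun i => u i + v i).
Proof. by move=> uN vN i; have := uN i; have := vN i; lia. Qed.

Lemma in_cube0 (N : nat) : in_cube N (fun _ : 'I_m => 0).
Proof. by move=> i; lia. Qed.

Lemma exists_in_cube (u : 'I_m -> int) : exists N, in_cube N u.
Proof.
exists (\max_i `|u i|%N)%N => i.
by have := leq_bigmax (F := fun i => `|u i|%N) i; lia.
Qed.

(** Extreme coordinates are pulled in by one; this permits induction on the radius by unit moves. *)
Lemma in_cubeS (N : nat) (u : 'I_m -> int) : in_cube N.+1 u ->
  exists v w, [/\ in_cube N v, in_cube 1 w & u = fun i => w i + v i].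
Proof.
move=> uN; exists (fun i => if u i == N.+1%:Z then N%:Z else
  if u i == - N.+1%:Z then - N%:Z else u i).
exists (fun i => if u i == N.+1%:Z then 1 else
  if u i == - N.+1%:Z then -1 else 0); split.
- by move=> i; have := uN i; case: eqP => ?; [|case: eqP => ?]; lia.
- by move=> i; case: eqP => ?; [|case: eqP => ?]; lia.
- by apply/funext => i; case: eqP => ?; [|case: eqP => ?]; lia.
Qed.

End Cubes.

(** * Contraction of chains *)

Section Chains.
Variables (X : Type) (V : nat -> X -> X -> Prop).

Fixpoint chain (l n : nat) (x y : X) : Prop :=
  if n is n'.+1 then exists z, chain l n' x z /\ V l z y else x = y.

Lemma chainD l a b x y :
  chain l (a + b) x y -> exists z, chain l a x z /\ chain l b z y.
Proof.
elim: b y => [|b IH] y; first by rewrite addn0 => ?; exists y.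
rewrite addnS => -[w [/IH[z [xz zw]] wy]]; exists z; split => //=.
by exists w.
Qed.

Hypothesis V_refl : forall l x, V l x x.
Hypothesis V_half : forall l x y z, V l.+1 x y -> V l.+1 y z -> V l x z.

Lemma chain_le l a b x y : (a <= b)%N -> chain l a x y -> chain l b x y.
Proof.
move=> /subnK <-; elim: (b - a)%N => // c IH xy.
by rewrite addSn; exists y; split; [exact: IH | exact: V_refl].
Qed.

(** As in the metrization of uniform spaces: cut the chain in the middle, contract each half to one
    step of level [l.+1], and merge the two by [V_half]. *)
Lemma chain_contract l k n x y :
  (n <= 2 ^ k)%N -> chain (l + k) n x y -> V l x y.
Proof.
move=> nk /(chain_le nk) {nk n}; elim: k l x y => [|k IH] l x y.
  by rewrite addn0 => -[z [<-]].
rewrite expnS mul2n -addnn addnS -addSn => /chainD[z [/IH xz /IH zy]].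
exact: V_half xz zy.
Qed.

End Chains.

Section CompactMetric.
Variables (R : realType) (X : Type) (d : X -> X -> R).
Hypothesis dm : is_metric d.
Hypothesis dc : mcompact d.

Let d_refl x : d x x = 0. Proof. by case: dm => _ [/(_ x x)[_ ->]]. Qed.
Let d_sym x y : d x y = d y x. Proof. by case: dm => _ [_ []]. Qed.
Let d_tri y x z : d x z <= d x y + d y z. Proof. by case: dm => _ [_ [_]]. Qed.

Lemma mopen_ball x r : mopen d [set y | d x y < r].
Proof.
move=> y /= xy; exists (r - d x y); split; first by lra.
by move=> z; have := d_tri y x z; lra.
Qed.

Lemma exists_inv_lt (e : R) : 0 < e -> exists n : nat, n.+1%:R^-1 < e.
Proof. by move=> /ltr_add_invr[n]; rewrite add0r => ?; exists n. Qed.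

Lemma inv_le (a b : nat) : (a <= b)%N -> b.+1%:R^-1 <= a.+1%:R^-1 :> R.
Proof. by move=> ab; rewrite lef_pV2 ?posrE ?ltr0n// ler_nat. Qed.

(** Monotonicity lets the largest of the finitely many indices given by a subcover serve
    everywhere. *)
Lemma compact_uniform (Q : nat -> X -> Prop) :
  (forall m n x, (m <= n)%N -> Q m x -> Q n x) ->
  (forall x, exists r n, 0 < r /\ forall y, d x y < r -> Q n y) ->
  exists n, forall x, Q n x.
Proof.
move=> mono /choice[r /choice[n rn]].
have [|x|k [f fP]] := dc (U := fun x => [set y | d x y < r x]).
- by move=> x; exact: mopen_ball.
- by exists x; rewrite /= d_refl; case: (rn x).
exists (\max_j n (f j))%N => x; have [j jx] := fP x.
apply: mono (leq_bigmax j) _.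
by have [_] := rn (f j); exact.
Qed.

(** Makes the supremum in [bowen] a true one rather than a default value. *)
Lemma metric_bounded : exists B : R, forall x y, d x y <= B.
Proof.
have [[p]|nX] := pselect (inhabited X); last by exists 0 => x; case: nX; exists.
have [||n nP] := @compact_uniform (fun n x => d p x <= n%:R).
- by move=> a b x ab /le_trans; apply; rewrite ler_nat.
- move=> x; exists 1, (Num.truncn (d p x + 1)).+1; split => // y xy.
  have := truncnS_gt (d p x + 1); have := d_tri x p y; lra.
exists (n%:R + n%:R) => x y; have := d_tri p x y; rewrite (d_sym x p).
by have := nP x; have := nP y; lra.
Qed.

Definition tclose (m : nat) (S : ('I_m -> int) -> X -> X) (c : R) (L : nat)
  (x y : X) : Prop := forall u, in_cube L u -> d (S u x) (S u y) <= c.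

Section Action.
Variables (m : nat) (S : ('I_m -> int) -> X -> X).
Hypothesis cS : continuous_action d S.

Lemma bowen_ge N x y u : in_cube N u -> d (S u x) (S u y) <= bowen d S N x y.
Proof.
move=> uN; have [B dB] := metric_bounded.
by apply: ub_le_sup; [exists B => _ [v _ <-] | exists u].
Qed.

Lemma bowen_le N x y c : tclose S c N x y -> bowen d S N x y <= c.
Proof.
move=> h; apply: ge_sup; last by move=> _ [u uN <-]; exact: h.
by exists (d (S (fun=> 0) x) (S (fun=> 0) y)), (fun=> 0) => //; exact: in_cube0.
Qed.

Lemma cube_unif_continuous L e : 0 < e -> exists dl, 0 < dl /\
  forall x y, d x y < dl -> forall u, in_cube L u -> d (S u x) (S u y) < e.
Proof.
move=> e0.
have [||n nP] := @compact_uniform (fun n x => forall y, d x y < n.+1%:R^-1 ->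
    forall u, in_cube L u -> d (S u x) (S u y) < e).
- by move=> a b x ab h y xy; apply: h; apply: lt_le_trans xy (inv_le ab).
- move=> x.
  have [||r [r0 h]] := @common_radius R {ffun 'I_m -> 'I_(2 * L + 1)}
      (fun j r => forall y, d x y < r -> d (S (cube_point j) x) (S (cube_point j) y) < e / 2).
  + by move=> j r s sr h y xy; apply: h; exact: lt_le_trans xy sr.
  + by move=> j; case: cS => _ /(_ (cube_point j) x (e / 2)); apply; lra.
  have [|n nr] := @exists_inv_lt (r / 2); first by lra.
  exists (r / 2), n; split; first by lra.
  move=> x' xx' y x'y u /cube_pointP[j ->].
  have /(h j) : d x x' < r by lra.
  have /(h j) : d x y < r by have := d_tri x' x y; have := lt_trans x'y nr; lra.
  have := d_tri (S (cube_point j) x) (S (cube_point j) x') (S (cube_point j) y).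
  rewrite (d_sym (S (cube_point j) x') (S (cube_point j) x)); lra.
exists n.+1%:R^-1; split; first by rewrite invr_gt0 ltr0n.
by move=> x y /nP.
Qed.

Lemma tcloseD c L M x y u : tclose S c (L + M) x y -> in_cube M u ->
  tclose S c L (S u x) (S u y).
Proof.
move=> h uM v vL; case: cS => -[_ SD] _.
by rewrite -!SD; apply/h/in_cubeD.
Qed.

Lemma tclose_le c L M x y : (L <= M)%N -> tclose S c M x y -> tclose S c L x y.
Proof. by move=> LM h u uL; apply/h/(in_cube_le LM). Qed.

Lemma tclose_refl c L x : 0 <= c -> tclose S c L x x.
Proof. by move=> c0 u _; rewrite d_refl. Qed.

(** Uniform continuity makes the set of cover sizes nonempty, so its least element is a lower bound
    for the infimum. A point of [X] forces [0 < M], which [ln] needs later. *)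
Lemma covnum_cover N e : 0 < e -> inhabited X ->
  exists M (W : 'I_M -> set X), [/\ (0 < M)%N, M%:R <= covnum d (bowen d S N) e,
    forall x, exists w, W w x &
    forall w x y, W w x -> W w y -> tclose S e N x y].
Proof.
move=> e0 [p]; pose E : set nat := [set n : nat | exists U : 'I_n -> set X,
         (forall i, mopen d (U i) /\ (diam (bowen d S N) (U i) < e%:E)%E) /\
         (forall x, exists i, U i x)].
have exE : exists n, `[< E n >].
  have [|r [r0 h]] := @cube_unif_continuous N (e / 3); first by lra.
  have [|x|n [f fP]] := dc (U := fun x => [set y | d x y < r]).
  - by move=> x; exact: mopen_ball.
  - by exists x; rewrite /= d_refl.
  exists n; apply/asboolP; exists (fun j => [set y | d (f j) y < r]); split => // i.
  split; first exact: mopen_ball.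
  apply: (@le_lt_trans _ _ (e / 3 * 2)%:E); last by rewrite lte_fin; lra.
  apply: ge_ereal_sup => _ [x /= xr [y /= yr <-]]; rewrite lee_fin.
  apply: bowen_le => u uN.
  have := h _ _ xr u uN; have := h _ _ yr u uN.
  have := d_tri (S u (f i)) (S u x) (S u y); rewrite (d_sym (S u x) (S u (f i))); lra.
case: (ex_minnP exE) => M /asboolP[W [oW cW]] minM.
exists M, W; split => //.
- by have [w _] := cW p; case: w => w /=; exact: leq_ltn_trans.
- apply: lb_le_inf; first by exists M%:R, M => //; exists W.
  by move=> _ [n En <-]; rewrite ler_nat; apply: minM; apply/asboolP.
- move=> w x y Wx Wy u uN; apply: le_trans (bowen_ge x y uN) _.
  rewrite -lee_fin; apply: le_trans (ltW (proj2 (oW w))).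
  by apply: ereal_sup_ubound; exists x => //; exists y.
Qed.

End Action.

Section Expansive.
Variables (m : nat) (S : ('I_m -> int) -> X -> X) (c : R).
Hypothesis cS : continuous_action d S.
Hypothesis c0 : 0 < c.
Hypothesis exp : forall x y, x <> y -> exists u, c < d (S u x) (S u y).

(** Compactness is used in [y], then in [x]. Near the diagonal the points are already close; off it
    some [S u] separates them beyond [c], and by continuity it also separates nearby pairs. *)
Lemma expansive_uniform e : 0 < e ->
  exists L, forall x y, tclose S c L x y -> d x y < e.
Proof.
move=> e0.
apply: (@compact_uniform (fun L x => forall y, tclose S c L x y -> d x y < e)).
  by move=> a b x ab h y /(tclose_le ab); exact: h.
move=> x.
have [||L h] := @compact_uniform (fun L y => forall x', d x x' < L.+1%:R^-1 ->
    tclose S c L x' y -> d x' y < e).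
- move=> a b y ab h x' xx' /(tclose_le ab); apply: h.
  by apply: lt_le_trans xx' (inv_le ab).
- move=> y; have [<-|/exp[u cu]] := pselect (x = y).
    have [|n nr] := @exists_inv_lt (e / 2); first by lra.
    exists (e / 2), n; split; first by lra.
    move=> y' xy' x' xx' _; have := d_tri x x' y'; rewrite (d_sym x' x).
    by have := lt_trans xx' nr; lra.
  (* Half the excess over [c]: moving each of the two points costs less than [g]. *)
  pose g := (d (S u x) (S u y) - c) / 2; have g0 : 0 < g by rewrite /g; lra.
  case: cS => _ /(_ u) cu'.
  have [r [r0 hr]] := cu' x g g0; have [s [s0 hs]] := cu' y g g0.
  have [n nr] := exists_inv_lt r0.
  have [L uL] := exists_in_cube u.
  exists s, (maxn n L); split => // y' /hs yy' x' xx'.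
  move=> /(_ u (in_cube_le (leq_maxr n L) uL)).
  have /hr xx : d x x' < r.
    by apply: lt_trans xx' (le_lt_trans _ nr); apply: inv_le; exact: leq_maxl.
  have := d_tri (S u x') (S u x) (S u y); have := d_tri (S u y') (S u x') (S u y).
  rewrite (d_sym (S u y') (S u y)); move: xx yy'; rewrite /g; lra.
exists L.+1%:R^-1, L; split; first by rewrite invr_gt0 ltr0n.
by move=> x' xx' y; exact: h.
Qed.

(** Uniform expansivity is applied at every time of the cube, so one [L] serves all [M]. *)
Lemma expansive_half : exists L, forall M x y,
  tclose S c (L + M) x y -> tclose S (c / 2) M x y.
Proof.
have [|L h] := @expansive_uniform (c / 2); first by rewrite divr_gt0.
by exists L => M x y /tcloseD xy u /(xy cS)/h/ltW.
Qed.

(** A unit move of [S'] takes [dl]-close points to [c]-close ones, and [S]-closeness at radius [L]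
    gives [dl]-closeness. By commutation this holds along the [S]-orbits, so each unit move costs
    [L] in radius. *)
Lemma commuting_tclose (m' : nat) (S' : ('I_m' -> int) -> X -> X) :
  continuous_action d S' -> commuting S S' ->
  exists L, forall N M x y, tclose S c (L * N + M) x y ->
    forall v, in_cube N v -> tclose S c M (S' v x) (S' v y).
Proof.
move=> cS' comm.
have [dl [dl0 hdl]] := @cube_unif_continuous _ S' cS' 1 c c0.
have [L hL] := expansive_uniform dl0.
exists L; elim=> [|N IH] M x y xy v.
  move=> v0; have -> : v = fun=> 0 by apply/funext => i; have := v0 i; lia.
  by case: cS' => -[S'0 _] _; rewrite !S'0; rewrite muln0 in xy.
move=> /in_cubeS[w [z [wN z1 ->]]] u uM.
case: (cS') => -[_ S'D] _; rewrite !S'D !comm; apply/ltW/hdl => //; apply: hL.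
rewrite -!comm.
(* The induction hypothesis is used with [L + M] for [M]. *)
apply: (@tcloseD _ S cS _ _ M) => //; apply: IH => //.
by apply: tclose_le xy; rewrite mulnS; lia.
Qed.

End Expansive.

End CompactMetric.

(** * Mean dimension from entropy *)

Section MeanDimension.
Variables (R : realType) (X : Type) (d : X -> X -> R).
Hypothesis dm : is_metric d.
Hypothesis dc : mcompact d.

Let d_ge0 x y : 0 <= d x y. Proof. by case: dm. Qed.
Let d_refl x : d x x = 0. Proof. by case: dm => _ [/(_ x x)[_ ->]]. Qed.
Let d_sym x y : d x y = d y x. Proof. by case: dm => _ [_ []]. Qed.
Let d_tri y x z : d x z <= d x y + d y z. Proof. by case: dm => _ [_ [_]]. Qed.

Definition dist_set (B : set X) (x : X) : R := inf [set d x y | y in B].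

Lemma dist_set_le B x y : B y -> dist_set B x <= d x y.
Proof. by move=> By; apply: ge_inf; [exists 0 => _ [z _ <-] | exists y]. Qed.

Lemma dist_set_lt B x r : B !=set0 -> dist_set B x < r ->
  exists2 y, B y & d x y < r.
Proof.
move=> [b Bb] /inf_lt[]; first by exists (d x b), b.
by move=> _ [y By <-] ?; exists y.
Qed.

Lemma dist_set_lip B x y : B !=set0 -> `|dist_set B x - dist_set B y| <= d x y.
Proof.
move=> B0; suff h a b : dist_set B a <= d a b + dist_set B b.
  by rewrite ler_norml; have := h x y; have := h y x; rewrite (d_sym y x); lra.
rewrite -lerBlDl; apply: lb_le_inf; first by case: B0 => z Bz; exists (d b z), z.
by move=> _ [z Bz <-]; have := dist_set_le a Bz; have := d_tri b a z; lra.
Qed.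

Variables (k m : nat) (T : ('I_k -> int) -> X -> X) (S : ('I_m -> int) -> X -> X).
Hypothesis cT : continuous_action d T.
Hypothesis cS : continuous_action d S.
Hypothesis comm : commuting T S.
Variable c : R.
Hypothesis c0 : 0 < c.
Hypothesis exp : forall x y, x <> y -> exists u, c < d (T u x) (T u y).

(** The size condition is that of the union bound with [2 ^ N] layers for each of
    [D * (2 * N + 1) ^ m] pairs (time, centre). *)
Lemma widim_le_of_cover eps : 0 < eps -> exists L L' D : nat,
  forall N M (W : 'I_M -> set X),
    (forall x, exists w, W w x) ->
    (forall w x y, W w x -> W w y -> tclose d T c (L * N + L') x y) ->
    forall n, (M * 2 ^ (D * (2 * N + 1) ^ m) < (2 ^ N) ^ n.+1)%N ->
    widim d (bowen d S N) eps <= n%:R.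
Proof.
move=> eps0.
have [L1 hL1] := commuting_tclose dm dc cT c0 exp cS comm.
have [L0 hL0] := expansive_half dm dc cT c0 exp.
have [|L2 hL2] := @expansive_uniform _ _ _ dm dc _ _ _ cT exp (eps / 2).
  by rewrite divr_gt0.
pose V l := tclose d T c (L0 * l + L2).
have V_refl l x : V l x x by apply: tclose_refl => //; exact: ltW.
have V_half l x y z : V l.+1 x y -> V l.+1 y z -> V l x z.
  rewrite /V mulnS -addnA => /hL0 xy /hL0 yz u uL.
  have := xy u uL; have := yz u uL; have := d_tri (T u y) (T u x) (T u z).
  lra.
have V_near l : exists dl, 0 < dl /\ forall x y, d x y < dl -> V l x y.
  have [dl [dl0 h]] := cube_unif_continuous dm dc cT (L0 * l + L2) c0.
  by exists dl; split => // x y xy u uL; apply/ltW/h.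
(* Centres are taken at level 1, so that one more [V 1] step stays within [V 0], hence within
   [eps / 2]. *)
have [r [r0 hr]] := V_near 1%N.
have [|x|D [p hp]] := dc (U := fun x => [set y | d x y < r]).
- by move=> x; exact: mopen_ball.
- by exists x; rewrite /= d_refl.
(* [L1 * N] pays for moving by [S] over the cube; [L0 * (N + 2) + L2] is the radius of [V N.+2]. *)
exists (L1 + L0)%N, (L0 * 2 + L2)%N, D => N M W cW closeW n small.
have [dl [dl0 hdl]] := V_near N.+2.
pose B (i : 'I_D) (t : nat) : set X :=
  [set x | exists z, V 1%N (p i) z /\ chain V N.+2 t z x].
have B_ne i t : B i t !=set0.
  by exists (p i), (p i); split => //; exact: (chain_le V_refl (leq0n t)).
have B_le i s t x : (s <= t)%N -> B i s x -> B i t x.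
  by move=> st [z [pz zx]]; exists z; split => //; exact: (chain_le V_refl st).
have B_step i t x y : B i t x -> V N.+2 x y -> B i t.+1 y.
  by move=> [z [pz zx]] xy; exists z; split => //; exists x.
have B_near i t x : dist_set (B i t) x < dl -> B i t.+1 x.
  move=> /(dist_set_lt (B_ne i t))[y By xy]; apply: B_step By _.
  by apply: hdl; rewrite d_sym.
have B_small i t x : (t <= 2 ^ N.+1)%N -> B i t x -> d (p i) x < eps / 2.
  move=> tN [z [pz zx]].
  have zx1 : V 1%N z x.
    by apply: (chain_contract V_refl V_half (l := 1) tN); rewrite add1n.
  by have := V_half _ _ _ _ pz zx1; rewrite /V muln0 => /hL2.
pose A : finType := ({ffun 'I_m -> 'I_(2 * N + 1)} * 'I_D)%type.
pose f (a : A) (t : nat) (x : X) : R :=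
  dist_set (B a.2 t) (S (cube_point a.1) x) - dl / 2.
pose crit (w : 'I_M) (a : A) (s : 'I_(2 ^ N)) :=
  `[< exists2 x, W w x & f a (2 * s)%N x = 0 >].
(* If [s < t], the image of [x] lies in the set of index [2 * s + 1], so that of [y] lies in the one
   of index [2 * s + 2], hence of index [2 * t]: its distance is 0, not [dl / 2]. Odd indices leave
   room for this. *)
have crit_le w a s t : crit w a s -> crit w a t -> (t <= s)%N.
  move=> /asboolP[x Wx fx] /asboolP[y Wy fy]; rewrite leqNgt; apply/negP => st.
  have Bx : B a.2 (2 * s).+1%N (S (cube_point a.1) x).
    by apply: B_near; move: fx; rewrite /f; lra.
  have Vxy : V N.+2 (S (cube_point a.1) x) (S (cube_point a.1) y).
    apply: (hL1 N); last exact: in_cube_point.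
    apply: tclose_le (closeW _ _ _ Wx Wy); lia.
  have By : B a.2 (2 * t)%N (S (cube_point a.1) y).
    by apply: B_le (B_step _ _ _ _ Bx Vxy); lia.
  by have := dist_set_le (S (cube_point a.1) y) By; move: fy; rewrite /f d_refl; lra.
have [|||xi hxi] := @exists_few_simultaneous A (2 ^ N) M n.+1 crit.
- by rewrite expn_gt0.
- move=> w a s t cs ct; apply/val_inj/eqP; rewrite eqn_leq /=.
  by rewrite (crit_le w a t s) ?(crit_le w a s t).
- by rewrite card_prod card_ffun !card_ord [((_ ^ _) * D)%N]mulnC.
have xi_lt a : (xi a < 2 ^ N)%N by case: (xi a).
apply: (@widim_le_zeros _ _ _ A (fun a => f a (2 * xi a)%N) (dl / 2)).
- by rewrite divr_gt0.
- move=> a x e e0; have [s [s0 hs]] := proj2 cS (cube_point a.1) x e e0.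
  exists s; split => // y /hs; apply: le_lt_trans.
  rewrite /f opprB addrA subrK.
  exact: dist_set_lip.
- move=> x Z hZ; have [w Wx] := cW x; rewrite -ltnS; apply: (hxi w) => a aZ.
  by apply/asboolP; exists x => //; exact: hZ.
- move=> x y h; apply: bowen_le => u /cube_pointP[j ->].
  (* A centre [i] near the image of [x] has that image in every [B i t]. The image of [y] is then
     within [dl] of the chosen set, so it lies in the next one, and both are [eps / 2]-close to
     [p i]. *)
  have [i /hr pi] := hp (S (cube_point j) x).
  have Bx t : B i t (S (cube_point j) x).
    by apply: (B_le _ 0%N) => //; exists (S (cube_point j) x).
  have fx : f (j, i) (2 * xi (j, i))%N x <= 0.
    by have := dist_set_le (S (cube_point j) x) (Bx (2 * xi (j, i))%N); rewrite /f /= d_refl; lra.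
  have By : B i (2 * xi (j, i)).+1%N (S (cube_point j) y).
    by apply: B_near; have := h _ fx; rewrite /f /=; lra.
  have := B_small _ _ _ _ (Bx 0%N) => /(_ isT).
  have : ((2 * xi (j, i)).+1 <= 2 ^ N.+1)%N by rewrite expnS; have := xi_lt (j, i); lia.
  move=> /B_small/(_ By).
  have := d_tri (p i) (S (cube_point j) x) (S (cube_point j) y).
  by rewrite (d_sym _ (p i)); lra.
Qed.

(** * Entropy estimates *)

Lemma covers_of_htop0 : inhabited X -> is_htop d T 0%E -> forall g : R, 0 < g ->
  exists N0, forall N, (N0 <= N)%N -> exists M (W : 'I_M -> set X),
    [/\ (0 < M)%N, ln (M%:R : R) <= g * ((2 * N + 1) ^ k)%:R,
      forall x, exists w, W w x &
      forall w x y, W w x -> W w y -> tclose d T c N x y].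
Proof.
move=> nX [h [hN h0]] g g0.
have lt_nbhs : nbhs (0%E : \bar R) [set y | (y < g%:E)%E].
  by apply: open_nbhs_nbhs; split; [exact: open_ereal_lt_ereal | rewrite /= lte_fin].
(* A single scale suffices: it must be at most [c] and have growth rate below [g]. *)
have [e [e0 ec he]] : exists e : R, [/\ 0 < e, e <= c & (h e < g%:E)%E].
  have near0 : nbhs 0^'+
      ([set e : R | 0 < e] `&` ([set e | e <= c] `&` [set e | (h e < g%:E)%E])).
    apply: filterI; first exact: nbhs_right_gt.
    by apply: filterI; [exact: nbhs_right_le | exact: (h0 _ lt_nbhs)].
  have [e [/= e0 [/= ec he]]] := @filter_ex _ _ (at_right_proper_filter (0 : R)) _ near0.
  by exists e.
have : nbhs (h e) [set y | (y < g%:E)%E].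
  by apply: open_nbhs_nbhs; split; [exact: open_ereal_lt_ereal | ].
move=> /(hN e e0)[N0 _ hN0]; exists N0 => N /hN0 /=; rewrite lte_fin => lnN.
have [M [W [M0 Mle cW closeW]]] := covnum_cover dm dc cT N e0 nX.
exists M, W; split => //; last first.
  by move=> w x y Wx Wy u uN; apply: le_trans ec; exact: (closeW w).
rewrite ltr_pdivrMr in lnN; last by rewrite ltr0n expn_gt0 addn1.
apply: le_trans (ltW lnN); rewrite ler_ln ?posrE ?ltr0n//.
by apply: lt_le_trans Mle; rewrite ltr0n.
Qed.

(** After taking logarithms the budget is [b * N * P * ln 2], with [P] the number of times in the
    cube; [ln M] and the term [D * P * ln 2] get half each. *)
Lemma widim_sublinear : k = m.+1 -> inhabited X -> is_htop d T 0%E ->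
  forall eps b : R, 0 < eps -> 0 < b -> exists N0, forall N, (N0 <= N)%N ->
    widim d (bowen d S N) eps <= b * ((2 * N + 1) ^ m)%:R.
Proof.
move=> km nX hT eps b eps0 b0.
have [L [L' [D widim_cover]]] := widim_le_of_cover eps0.
(* Bounds the ratio of the sides of the cubes of radius [L.+1 * N + L'] and [N]. Using [L.+1] makes
   the larger radius at least [N], hence at least [N1]. *)
pose C := (L + L' + 2)%N.
have C_ge N : (0 < N)%N -> (2 * (L.+1 * N + L') + 1 <= C * (2 * N + 1))%N.
  by move=> N0; rewrite /C; clear - N0; nia.
have ln2 : 0 < ln (2 : R) by apply: ln_gt0; rewrite ltr1n.
have C0 : 0 < (C ^ k)%:R :> R by rewrite ltr0n expn_gt0 /C addn2.
(* The 6 is 2 for the half budget times 3 from [2 * N + 1 <= 3 * N]. *)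
pose g := b * ln 2 / (6 * (C ^ k)%:R).
have g0 : 0 < g by rewrite /g divr_gt0 ?mulr_gt0.
have [N1 cover] := covers_of_htop0 nX hT g0.
(* The second threshold gives [2 * D < b * N], the other half of the budget. *)
exists (maxn N1 (Num.truncn (2 * D%:R / b)).+1) => N; rewrite geq_max => /andP[N1N DN].
have [|M [W [M0 lnM' cW closeW]]] := cover (L.+1 * N + L')%N; first by lia.
set P := ((2 * N + 1) ^ m)%N; have PE : P = ((2 * N + 1) ^ m)%N by [].
have P0 : 0 < P%:R :> R by rewrite ltr0n expn_gt0 addn1.
clearbody P.
have bP0 : 0 <= b * P%:R by rewrite mulr_ge0 ?ler0n ?ltW.
(* With [n] the integer part of [b * P], the exponent [n.+1] exceeds [b * P]. *)
apply: (@le_trans _ _ (Num.truncn (b * P%:R))%:R); last first.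
  by rewrite truncn_le.
apply: (@widim_cover N M W cW).
  move=> w x y Wx Wy; apply: tclose_le (closeW _ _ _ Wx Wy).
  by rewrite mulSn -addnA leq_addl.
rewrite -PE -(ltr_nat R) -ltr_ln ?posrE ?ltr0n ?muln_gt0 ?expn_gt0 ?M0//.
rewrite natrM lnM ?posrE ?ltr0n ?expn_gt0// -expnM !natrX !lnXn ?ltr0n//.
rewrite -[_ *+ (D * P)]mulr_natr -[_ *+ (N * _)]mulr_natr (natrM _ D) (natrM _ N).
have tr := truncnS_gt (b * P%:R); set n := (Num.truncn (b * P%:R)).+1 in tr *.
have N0 : (0 < N)%N by exact: leq_trans DN.
have NN : (1 : R) <= N%:R by rewrite ler1n.
have DN' : 2 * D%:R / b < N%:R.
  by apply: lt_le_trans (truncnS_gt _) _; rewrite ler_nat.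
rewrite ltr_pdivrMr// in DN'.
have lnM1 : ln M%:R <= b * ln 2 / 2 * N%:R * P%:R.
  apply: le_trans lnM' _.
  apply: (@le_trans _ _ (g * (C ^ k * ((2 * N + 1) * P))%:R)).
    rewrite ler_pM2l// ler_nat PE -expnS -km -expnMn leq_exp2r ?km//.
    exact: C_ge.
  rewrite /g !natrM natrD natrM.
  have -> : b * ln 2 / (6 * (C ^ k)%:R) * ((C ^ k)%:R * ((2 * N%:R + 1) * P%:R)) =
      b * ln 2 / 6 * (2 * N%:R + 1) * P%:R :> R.
    by field; rewrite gt_eqF.
  rewrite ler_pM2r//.
  have -> : b * ln 2 / 2 * N%:R = b * ln 2 / 6 * (3 * N%:R) :> R by field.
  by rewrite ler_pM2l ?divr_gt0 ?mulr_gt0//; lra.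
have : ln 2 * D%:R * P%:R < b * ln 2 / 2 * N%:R * P%:R.
  rewrite ltr_pM2r//.
  have -> : b * ln 2 / 2 * N%:R = ln 2 * (b * N%:R / 2) :> R by field.
  by rewrite ltr_pM2l//; lra.
have : ln 2 * N%:R * (b * P%:R) < ln 2 * N%:R * n%:R by rewrite ltr_pM2l// mulr_gt0//; lra.
by lra.
Qed.

Lemma is_mdim0 : k = m.+1 -> inhabited X -> is_htop d T 0%E -> is_mdim d S 0%E.
Proof.
move=> km nX hT; exists (fun=> 0%E); split; last exact: cvg_cst.
move=> eps eps0; apply/fine_cvgP; split; first by near=> N.
apply/cvgrPdist_le => b b0.
have [N0 hN0] := widim_sublinear km nX hT eps0 b0.
exists N0 => // N /= /hN0 h.
rewrite sub0r normrN ger0_norm; last by rewrite divr_ge0 ?widim_ge0.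
by rewrite ler_pdivrMr// ltr0n expn_gt0 addn1.
Unshelve. all: by end_near.
Qed.

End MeanDimension.

Theorem theorem1p8 (k : nat) (X : Type) (d : X -> X -> Rdefinitions.R)
  (T : ('I_k -> int) -> X -> X) (R : ('I_(k.-1) -> int) -> X -> X) :
  (1 <= k)%N ->
  is_metric d -> mcompact d -> inhabited X ->
  continuous_action d T -> expansive d T ->
  continuous_action d R -> commuting T R ->
  is_htop d T 0%E ->
  is_mdim d R 0%E.
Proof.
move=> k1 dm dc nX cT [c [c0 exp]] cR comm hT.
apply: (is_mdim0 dm dc cT cR comm c0) => //; last by rewrite prednK.
move=> x y /exp/ereal_sup_gt[_ [u _ <-]]; rewrite lte_fin => cu.
by exists u.
Qed.
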